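(* For every directed temporal graph $\mathcal{G}=(V,E,\lambda)$ (with non-strict temporal paths) there exists a proper directed temporal graph $\mathcal{H}$ on the same vertex set $V$ such that for every sequence of distinct vertices $(v_0,v_1,\dots,v_k)$, $k\ge1$, there is a non-strict temporal path in $\mathcal{G}$ visiting exactly $v_0,\dots,v_k$ in this order if and only if there is a strict temporal path in $\mathcal{H}$ visiting exactly $v_0,\dots,v_k$ in this order. In particular $\mathcal{G}$ (setting D \& non-strict) and $\mathcal{H}$ (setting D \& proper) are support equivalent.
   Context: A directed temporal graph is a triple $\mathcal{G}=(V,E,\lambda)$ with $V$ a finite vertex set, $E\subseteq\{(u,v)\in V\times V: u\ne v\}$ a set of arcs, and $\lambda$ assigns to each arc a nonempty finite set of time labels (real time labels may be used; they can be renormalized to positive integers preserving order). $\mathcal{G}$ is proper if no two distinct arcs incident to a common vertex share a time label. A temporal path from $u$ to $v$ is a sequence $(e_1,t_1),\dots,(e_k,t_k)$, $k\ge1$, with $t_i\in\lambda(e_i)$, such that $e_1,\dots,e_k$ form a directed path from $u$ to $v$ in $(V,E)$ (distinct vertices) and $t_1\le\dots\le t_k$; it is strict if $t_1<\dots<t_k$. Two temporal graphs on the same vertex set are support equivalent if for every temporal path (of the kind their setting prescribes) in either graph there is one in the other visiting the same vertices in the same order. *)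

(* Defs.v *)
From HB Require Import structures.
From mathcomp Require Import all_boot all_order all_algebra finmap.
From mathcomp Require Import reals.

Set Implicit Arguments.
Unset Strict Implicit.
Unset Printing Implicit Defensive.

Import Order.TTheory GRing.Theory Num.Theory.
Local Open Scope ring_scope.

(* The values of [labels] outside [arcs] are irrelevant: every notion below
   consults [labels e] only for [e \in arcs]. *)
Record tgraph (R : realType) (V : finType) := TGraph {
  arcs : {set V * V};
  labels : V * V -> {fset R};
  arcs_loopless : forall e : V * V, e \in arcs -> e.1 != e.2;
  labels_nonempty : forall e : V * V, e \in arcs -> labels e != fset0
}.

Definition incident (V : finType) (x : V) (e : V * V) : bool :=
  (x == e.1) || (x == e.2).

Definition proper_tgraph (R : realType) (V : finType) (G : tgraph R V) : Prop :=
  forall (e f : V * V) (x : V) (t : R),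
    e \in arcs G -> f \in arcs G -> e != f ->
    incident x e -> incident x f ->
    ~ (t \in labels G e /\ t \in labels G f).

Inductive path_kind := NonStrict | Strict.

Definition time_rel (R : realType) (k : path_kind) : rel R :=
  match k with
  | NonStrict => fun s t => s <= t
  | Strict => fun s t => s < t
  end.

Definition visited (R : realType) (V : finType) (p : seq ((V * V) * R)) : seq V :=
  match p with
  | [::] => [::]
  | (e, _) :: _ => e.1 :: [seq et.1.2 | et <- p]
  end.

Definition temporal_path (R : realType) (V : finType) (k : path_kind)
    (G : tgraph R V) (p : seq ((V * V) * R)) : Prop :=
  [/\ p <> [::],
      forall et, et \in p -> et.1 \in arcs G /\ et.2 \in labels G et.1,
      sorted (fun a b : (V * V) * R => a.1.2 == b.1.1) p,
      uniq (visited p)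
    & sorted (@time_rel R k) [seq et.2 | et <- p] ].

(* [kG] and [kH] are the kinds of temporal path prescribed by the settings in
   which [G] and [H] are considered. *)
Definition support_equivalent (R : realType) (V : finType)
    (kG : path_kind) (G : tgraph R V) (kH : path_kind) (H : tgraph R V) : Prop :=
  (forall p, temporal_path kG G p ->
     exists2 q, temporal_path kH H q & visited q = visited p) /\
  (forall q, temporal_path kH H q ->
     exists2 p, temporal_path kG G p & visited p = visited q).

(* Main.v *)
Require Import Defs.
From HB Require Import structures.
From mathcomp Require Import all_boot all_order all_algebra finmap.
From mathcomp Require Import reals.

Set Implicit Arguments.
Unset Strict Implicit.
Unset Printing Implicit Defensive.

Import Order.TTheory GRing.Theory Num.Theory.

(* Every time [t] of [G] is blown up into a window of [#|V|] consecutive rounds,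
   and in each round every arc gets its own private instant; an arc carrying
   label [t] in [G] receives its instants of all rounds of window [t].  All
   instants are distinct, so the new graph is proper.  A path has fewer than
   [#|V|] arcs, so its [i]-th arc can be used in round [i] of its window, which
   makes it strict; conversely, reading off windows turns a strict path into a
   non-strict one. *)

Definition all_times (R : realType) (V : finType) (G : tgraph R V) : seq R :=
  flatten [seq (labels G e : seq R) | e <- enum (arcs G)].

(** A natural-number surrogate for [t], to be scaled into window positions. Times shared by several
    arcs are counted with multiplicity, so ranks may skip values; only their monotonicity
    matters. *)
Definition time_rank (R : realType) (V : finType) (G : tgraph R V) (t : R) : nat :=
  count (fun s => (s < t)%R) (all_times G).

Lemma mem_all_times (R : realType) (V : finType) (G : tgraph R V)
    (e : V * V) (t : R) :
  e \in arcs G -> t \in labels G e -> t \in all_times G.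
Proof.
by move=> eG tGe; apply/flatten_mapP; exists e; rewrite ?mem_enum.
Qed.

Lemma leq_time_rank (R : realType) (V : finType) (G : tgraph R V) (s t : R) :
  (s <= t)%R -> time_rank G s <= time_rank G t.
Proof. by move=> st; apply: sub_count => u /= /lt_le_trans; apply. Qed.

(** Strict because [s] itself is counted below [t] but not below [s]. *)
Lemma ltn_time_rank (R : realType) (V : finType) (G : tgraph R V) (s t : R) :
  s \in all_times G -> (s < t)%R -> time_rank G s < time_rank G t.
Proof.
rewrite /time_rank => sG st; elim: (all_times G) sG => //= u T IH.
rewrite inE => /predU1P[<-|/IH lt_st].
  rewrite ltxx st add0n add1n ltnS.
  by apply: sub_count => v /= /lt_trans; apply.
by rewrite -addnS leq_add //; case: ltP => // /lt_trans ->.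
Qed.

(** A mixed-radix numeral: window [a], then round [r] in radix [#|V|], then the arc as last digit in
    radix [#|{: V * V}|]. *)
Definition instant (V : finType) (a r : nat) (e : V * V) : nat :=
  (a * #|V| + r) * #|{: V * V}| + enum_rank e.

Lemma instant_arc_inj (V : finType) (a r b q : nat) (e f : V * V) :
  instant a r e = instant b q f -> e = f.
Proof.
move=> /(congr1 (modn^~ #|{: V * V}|)).
by rewrite !modnMDl !modn_small // => /ord_inj/enum_rank_inj.
Qed.

Lemma ltn_instant (V : finType) (a b r : nat) (e f : V * V) :
  a <= b -> instant a r e < instant b r.+1 f.
Proof.
move=> ab; rewrite /instant.
have ltM := ltn_ord (enum_rank e).
(* The separating value is the start of round [r.+1] in window [a]: passing to the next round
   outweighs any difference of arc digits. *)
apply: (@leq_trans ((a * #|V| + r).+1 * #|{: V * V}|)).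
  by rewrite mulSn addnC ltn_add2r.
by rewrite (leq_trans _ (leq_addr _ _)) // -addnS leq_mul2r leq_add2r
  leq_mul2r ab !orbT.
Qed.

(** By contraposition: if [b < a], the bound on [q] keeps the second instant before the start of
    window [b.+1], hence before every instant of window [a]. *)
Lemma instant_window (V : finType) (a b r q : nat) (e f : V * V) :
  q < #|V| -> instant a r e < instant b q f -> a <= b.
Proof.
move=> qV; apply: contraTT; rewrite -ltnNge -leqNgt => ba.
have ltM := ltn_ord (enum_rank f); rewrite /instant.
apply: (@leq_trans ((b * #|V| + q).+1 * #|{: V * V}|)).
  by rewrite mulSn addnC leq_add2r ltnW.
rewrite (leq_trans _ (leq_addr _ _)) // leq_mul2r; apply/orP; right.
apply: (@leq_trans (b.+1 * #|V|)); first by rewrite mulSn addnC -addSn leq_add2r.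
by rewrite (leq_trans _ (leq_addr _ _)) // leq_mul2r ba orbT.
Qed.

Definition stamp (R : realType) (V : finType) (G : tgraph R V)
    (r : nat) (e : V * V) (t : R) : R :=
  ((instant (time_rank G t) r e)%:R)%R.

Definition spread_labels (R : realType) (V : finType) (G : tgraph R V)
    (e : V * V) : {fset R} :=
  seq_fset tt [seq stamp G r e t | t <- labels G e, r <- iota 0 #|V|].

Lemma spread_labelsP (R : realType) (V : finType) (G : tgraph R V)
    (e : V * V) (c : R) :
  reflect (exists t r, [/\ t \in labels G e, r < #|V| & c = stamp G r e t])
          (c \in spread_labels G e).
Proof.
rewrite seq_fsetE; apply: (iffP allpairsP) => [[[t r] /= []]|[t [r [tGe rV ->]]]].
  by rewrite mem_iota => tGe rV ->; exists t, r.
by exists (t, r); rewrite mem_iota.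
Qed.

Lemma spread_labels_nonempty (R : realType) (V : finType) (G : tgraph R V)
    (e : V * V) :
  e \in arcs G -> spread_labels G e != fset0.
Proof.
move=> /labels_nonempty/fset0Pn[t tGe]; apply/fset0Pn.
exists (stamp G 0 e t); apply/spread_labelsP; exists t, 0; split=> //.
(* Round 0 exists because the arc has an endpoint, so [V] is nonempty. *)
by apply/card_gt0P; exists e.1.
Qed.

Definition spread (R : realType) (V : finType) (G : tgraph R V) : tgraph R V :=
  TGraph (@arcs_loopless _ _ G) (@spread_labels_nonempty _ _ G).

Lemma spread_proper (R : realType) (V : finType) (G : tgraph R V) :
  proper_tgraph (spread G).
Proof.
move=> e f x c _ _ /eqP ef _ _ [/spread_labelsP[t [r [_ _ ->]]]].
move=> /spread_labelsP[s [q [_ _ /eqP]]].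
by rewrite eqr_nat => /eqP/instant_arc_inj.
Qed.

Fixpoint spread_path (R : realType) (V : finType) (G : tgraph R V) (r : nat)
    (p : seq ((V * V) * R)) : seq ((V * V) * R) :=
  if p is (e, t) :: p' then (e, stamp G r e t) :: spread_path G r.+1 p'
  else [::].

Lemma spread_path_arcs (R : realType) (V : finType) (G : tgraph R V) (r : nat)
    (p : seq ((V * V) * R)) :
  unzip1 (spread_path G r p) = unzip1 p.
Proof. by elim: p r => //= -[e t] p IH r /=; rewrite IH. Qed.

Lemma mem_spread_path (R : realType) (V : finType) (G : tgraph R V) (r : nat)
    (p : seq ((V * V) * R)) (e : V * V) (c : R) :
  (e, c) \in spread_path G r p ->
  exists t q, [/\ (e, t) \in p, q < r + size p & c = stamp G q e t].
Proof.
elim: p r => //= -[f s] p IH r; rewrite inE => /predU1P[[-> ->]|/IH].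
  by exists s, r; rewrite mem_head addnS ltnS leq_addr.
by move=> [t [q [etp qr ->]]]; exists t, q; rewrite inE etp orbT addnS -addSn.
Qed.

Lemma spread_path_sorted (R : realType) (V : finType) (G : tgraph R V) (r : nat)
    (p : seq ((V * V) * R)) :
  sorted (@time_rel R NonStrict) (unzip2 p) ->
  sorted (@time_rel R Strict) (unzip2 (spread_path G r p)).
Proof.
elim: p r => //= -[e t] [//|[f s] p] IH r /= /andP[ts sp].
by rewrite ltr_nat ltn_instant ?leq_time_rank //=; apply: (IH r.+1).
Qed.

Lemma visited_arcs (R : realType) (V : finType) (p q : seq ((V * V) * R)) :
  unzip1 p = unzip1 q -> visited p = visited q.
Proof.
have visE (s : seq ((V * V) * R)) :
    visited s = if unzip1 s is e :: _ then e.1 :: unzip2 (unzip1 s) else [::].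
  by case: s => //= -[e t] s; rewrite /unzip1 /unzip2 -map_comp.
by rewrite !visE => ->.
Qed.

Lemma size_visited (R : realType) (V : finType) (p : seq ((V * V) * R)) :
  p <> [::] -> size (visited p) = (size p).+1.
Proof. by case: p => //= -[e t] p _ /=; rewrite size_map. Qed.

(** Retiming principle: linkage and distinctness of vertices depend only on the arcs, so only the
    labels and their order must be checked anew. *)
Lemma transfer_temporal_path (R : realType) (V : finType) (kG kH : path_kind)
    (G H : tgraph R V) (p q : seq ((V * V) * R)) :
  unzip1 q = unzip1 p ->
  (forall et, et \in q -> et.1 \in arcs H /\ et.2 \in labels H et.1) ->
  sorted (@time_rel R kH) (unzip2 q) ->
  temporal_path kG G p -> temporal_path kH H q /\ visited q = visited p.
Proof.
move=> qp inH sq [p0 _ linkp up _].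
have vqp := visited_arcs qp; split=> //; split=> //.
- by move=> q0; case: p p0 qp {linkp up vqp} => //; rewrite q0.
- have linkE (s : seq ((V * V) * R)) :
      sorted (fun a b : (V * V) * R => a.1.2 == b.1.1) s
      = sorted (fun e f : V * V => e.2 == f.1) (unzip1 s).
    by rewrite sorted_map.
  by rewrite linkE qp -linkE.
- by rewrite vqp.
Qed.

Lemma spread_temporal_path (R : realType) (V : finType) (G : tgraph R V)
    (p : seq ((V * V) * R)) :
  temporal_path NonStrict G p ->
  exists2 q, temporal_path Strict (spread G) q & visited q = visited p.
Proof.
move=> Gp; have [p0 inG _ up sp] := Gp.
(* A path visits one vertex more than it has arcs, so rounds 0 to [size p - 1] fit in a window. *)
have pV : size p < #|V|.
  by rewrite -size_visited // -(card_uniqP up) max_card.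
have [] := transfer_temporal_path (q := spread_path G 0 p) (H := spread G)
  (kH := Strict) (spread_path_arcs _ _ _) _ (spread_path_sorted _ _ sp) Gp.
  move=> [e c] /mem_spread_path[t [r [/inG/= [eG tGe] rp ->]]]; split=> //=.
  by apply/spread_labelsP; exists t, r; rewrite (ltn_trans rp).
by exists (spread_path G 0 p).
Qed.

Lemma unspread_temporal_path (R : realType) (V : finType) (G : tgraph R V)
    (q : seq ((V * V) * R)) :
  temporal_path Strict (spread G) q ->
  exists2 p, temporal_path NonStrict G p & visited p = visited q.
Proof.
move=> Hq; have [_ inH _ _ sq] := Hq.
pose origin (et : (V * V) * R) (t : R) :=
  [exists r : 'I_#|V|, et.2 == stamp G r et.1 t].
(* The first label of the arc whose window contains the instant; the default [et.2] is never reached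
   for entries of [q], by [backP]. *)
pose back et := nth et.2 (labels G et.1) (find (origin et) (labels G et.1)).
have backP et : et \in q -> (back et \in labels G et.1) && origin et (back et).
  move=> /inH[_ /spread_labelsP[t [r [tGe rV cE]]]].
  have has_origin : has (origin et) (labels G et.1).
    apply/hasP; exists t => //; apply/existsP.
    by exists (Ordinal rV); apply/eqP.
  by rewrite nth_find // andbT mem_nth // -has_find.
pose p := [seq (et.1, back et) | et <- q].
have pq : unzip1 p = unzip1 q by rewrite /unzip1 -map_comp.
have inG et : et \in p -> et.1 \in arcs G /\ et.2 \in labels G et.1.
  by move=> /mapP[d dq ->]; have [dG _] := inH _ dq; have /andP[] := backP _ dq.
have sp : sorted (@time_rel R NonStrict) (unzip2 p).
  rewrite /unzip2 -map_comp sorted_map; move: sq; rewrite sorted_map.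
  (* The comparison is restricted to entries of [q], since only there does [back] return genuine
     times of [G]. *)
  apply: (@sub_in_sorted _ (mem q)); last exact/allP.
  move=> d f dq fq /=.
  have [dG _] := inH _ dq; have [fG _] := inH _ fq.
  have /andP[dt /existsP[r /eqP ->]] := backP _ dq.
  have /andP[ft /existsP[u /eqP ->]] := backP _ fq.
  rewrite ltr_nat => /(instant_window (ltn_ord u)).
  (* Ordered windows give ordered times: [back f < back d] would make the rank of [back f] strictly
     smaller, as [back f] is a time of [G]. *)
  apply: contraTT; rewrite -ltNge -ltnNge => /ltn_time_rank; apply.
  exact: (@mem_all_times _ _ G f.1 (back f) fG ft).
by have [] := transfer_temporal_path pq inG sp Hq; exists p.
Qed.

Theorem theorem14 (R : realType) (V : finType) (G : tgraph R V) :
  exists H : tgraph R V,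
    [/\ proper_tgraph H,
        forall vs : seq V, uniq vs -> 1 < size vs ->
          ((exists2 p, temporal_path NonStrict G p & visited p = vs) <->
           (exists2 q, temporal_path Strict H q & visited q = vs))
      & support_equivalent NonStrict G Strict H].
Proof.
exists (spread G); split; first exact: spread_proper.
- move=> vs _ _; split=> -[p Gp <-].
    exact: spread_temporal_path.
  exact: unspread_temporal_path.
- by split=> p; [exact: spread_temporal_path|exact: unspread_temporal_path].
Qed.
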